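(* Any protocol solving the orthogonal vectors problem in which Alice and Bob each hold $n$ vectors of dimension $d = 2\lceil \log n\rceil + 3$ requires Alice and Bob to exchange $\Omega(n)$ bits.
   Context: The setting is the standard two-party communication model: Alice and Bob each hold a private input and exchange bits according to a protocol in order to determine the answer; the cost is the total number of bits exchanged in the worst case. Protocols may be deterministic, or randomized with bounded error (correct on every input with probability at least $2/3$). $\log$ is the base-2 logarithm. Orthogonal vectors problem (with $n$ vectors of dimension $d$): Alice holds a set of bit vectors $L = \{l_1,\dots,l_n\} \subseteq \{0,1\}^d$, Bob holds a set of bit vectors $R = \{r_1,\dots,r_n\}\subseteq \{0,1\}^d$, and they must determine whether there are $l_i \in L$ and $r_j \in R$ that are orthogonal, i.e., such that for every $1 \le k \le d$ we have $l_i[k] = 0$ or $r_j[k] = 0$. Known fact that may be used: any protocol (deterministic or bounded-error randomized) for set disjointness requires exchanging $\Omega(n)$ bits; in set disjointness Alice holds $x \in \{0,1\}^n$, Bob holds $y \in \{0,1\}^n$, and they must determine whether there is an index $k$ with $x[k]=y[k]=1$. *)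

(* Defs.v *)
From HB Require Import structures.
From mathcomp Require Import all_boot all_order all_algebra.
From mathcomp Require Import all_classical all_reals all_analysis.

Set Implicit Arguments.
Unset Strict Implicit.
Unset Printing Implicit Defensive.

Import Order.TTheory GRing.Theory Num.Theory.

Local Open Scope ring_scope.

(* Deterministic two-party protocols, as binary trees: at each internal node
   the owner sends one bit, computed from the owner's own input (the bits sent
   so far are recorded by the position in the tree); the run continues in the
   first subtree if the bit is [true] and in the second one otherwise. Whoever
   sees the whole exchange knows the leaf, hence the answer. *)
Inductive protocol (X Y : Type) : Type :=
  | Answer of bool
  | AliceSends of (X -> bool) & protocol X Y & protocol X Y
  | BobSends of (Y -> bool) & protocol X Y & protocol X Y.

Arguments Answer {X Y}.

Fixpoint run (X Y : Type) (p : protocol X Y) (x : X) (y : Y) : bool :=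
  match p with
  | Answer b => b
  | AliceSends a p1 p0 => if a x then run p1 x y else run p0 x y
  | BobSends b p1 p0 => if b y then run p1 x y else run p0 x y
  end.

Fixpoint bits_sent (X Y : Type) (p : protocol X Y) (x : X) (y : Y) : nat :=
  match p with
  | Answer _ => 0
  | AliceSends a p1 p0 =>
      (if a x then bits_sent p1 x y else bits_sent p0 x y).+1
  | BobSends b p1 p0 =>
      (if b y then bits_sent p1 x y else bits_sent p0 x y).+1
  end.

Definition cost (X Y : finType) (p : protocol X Y) : nat :=
  \max_(xy : X * Y) bits_sent p xy.1 xy.2.

Definition solves (X Y : Type) (p : protocol X Y) (f : X -> Y -> bool) : Prop :=
  forall x y, run p x y = f x y.

(* A randomized protocol is a random deterministic protocol: a probability [P]
   on a space [Omega] of coin outcomes and a family [prot] of protocols indexed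
   by [Omega]. This is the public-coin model; it contains the private-coin
   model, where [Omega] is a product with a product probability and the bits
   sent by Alice (Bob) depend on the first (second) component only. *)
Definition rand_solves (R : realType) (d : measure_display)
    (Omega : measurableType d) (P : probability Omega R) (X Y : Type)
    (prot : Omega -> protocol X Y) (f : X -> Y -> bool) : Prop :=
  forall x y,
    measurable [set w : Omega | run (prot w) x y = f x y]%classic /\
    ((2 / 3)%:E <= P [set w : Omega | run (prot w) x y = f x y]%classic)%E.

Definition rand_cost_le (Omega : Type) (X Y : finType)
    (prot : Omega -> protocol X Y) (c : nat) : Prop :=
  forall w, (cost (prot w) <= c)%N.

Definition bitvec (d : nat) := {ffun 'I_d -> bool}.

Definition orthogonal_bits (d : nat) (l r : bitvec d) : bool :=
  [forall k : 'I_d, (l k == false) || (r k == false)].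

Definition vec_set (n d : nat) := {L : {set bitvec d} | #|L| == n}.

Definition orthogonal_vectors (n d : nat) (L M : vec_set n d) : bool :=
  [exists l in val L, exists r in val M, orthogonal_bits l r].

(* 2 * ceil(log_2 n) + 3: for 0 < n, [up_log 2 n] is the least e such that
   n <= 2 ^ e. *)
Definition ov_dim (n : nat) : nat := (2 * up_log 2 n + 3)%N.

(* Main.v *)
(** Disjointness on coordinates [I] reduces to orthogonal vectors: prefixing the
    [i]th vectors by the bits of [i] and by their negations, swapped between the
    players, leaves only the pairs of equal indices. For disjointness, let [d] and
    [z] be uniform in [{0,1}^I] and give Alice [z] on [d] and Bob [z] outside [d],
    with zeros elsewhere. For fixed [d] the transcript of a [c]-bit protocol carries
    at most [c] bits about [z], so on average over [i] flipping [z i] moves its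
    distribution by [O(c / #|I|)] in squared Hellinger distance. Transcripts
    partition the inputs into rectangles, so by cut-and-paste the inputs (0,0) and
    (1,1) in coordinate [i] are equally hard to tell apart. The resulting bound on
    the advantage of a deterministic protocol is linear in the protocol, hence it
    passes to the average over the coins. *)
Require Import Defs.
From HB Require Import structures.
From mathcomp Require Import all_boot all_order all_algebra.
From mathcomp Require Import all_classical all_reals all_analysis.
From mathcomp Require Import measurable_realfun ring lra.

Set Implicit Arguments.
Unset Strict Implicit.
Unset Printing Implicit Defensive.

Import Order.TTheory GRing.Theory Num.Theory.

Local Open Scope ring_scope.

(** * Elementary inequalities for logarithms and square roots *)

Lemma ln_ge_quadratic (R : realType) (u : R) :
  - (1 / 4) <= u -> u - 2 * u ^+ 2 <= ln (1 + u).
Proof.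
move=> hu; have u1 : 0 < 1 + u by lra.
have /le_ln1Dx : -1 < (1 + u)^-1 - 1 by have := invr_gt0 (1 + u); rewrite u1; lra.
rewrite addrC subrK lnV ?posrE// => h.
(* Multiplied by [1 + u], the remaining inequality amounts to [0 <= u ^+ 2 * (1 + 2 * u)]. *)
suff : u - 2 * u ^+ 2 <= 1 - (1 + u)^-1 by lra.
rewrite -(ler_pM2r u1) [leRHS]mulrBl mulVf ?gt_eqF//.
have : 0 <= u ^+ 2 * (1 + 2 * u) by apply: mulr_ge0; [exact: sqr_ge0|lra].
rewrite !expr2; lra.
Qed.

Lemma ln_le_tangent (R : realType) (t s : R) :
  0 < t -> 0 < s -> ln t <= ln s + t / s - 1.
Proof.
move=> t0 s0.
have ts : 0 < t / s by exact: divr_gt0.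
have /le_ln1Dx : -1 < t / s - 1 by lra.
by rewrite addrC subrK ln_div ?posrE//; lra.
Qed.

Lemma ln_prod_pos (R : realType) (I : finType) (f : I -> R) :
  (forall i, 0 < f i) -> 0 < \prod_i f i /\ ln (\prod_i f i) = \sum_i ln (f i).
Proof.
move=> f0; apply: (big_rec2 (fun p s => 0 < p /\ ln p = s)).
  by rewrite ln1 ltr01.
by move=> i s p _ [p0 <-]; rewrite mulr_gt0// lnM ?posrE.
Qed.

(** Factor [a - b] as a difference of squares and use [a + b <= (Num.sqrt a + Num.sqrt b) ^+ 2]. If
    [a + b = 0], both sides vanish. *)
Lemma sqr_sqrtB_le (R : rcfType) (a b : R) : 0 <= a -> 0 <= b ->
  (Num.sqrt a - Num.sqrt b) ^+ 2 <= (a + b) * ((a - b) / (a + b)) ^+ 2.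
Proof.
move=> a0 b0.
have [ab0|ab0] := eqVneq (a + b) 0.
  have -> : a = 0 by lra.
  have -> : b = 0 by lra.
  by rewrite subrr expr0n addr0 mul0r.
have ab : 0 < a + b by rewrite lt_def ab0 addr_ge0.
have -> : (a + b) * ((a - b) / (a + b)) ^+ 2 = (a - b) ^+ 2 / (a + b) by field.
rewrite ler_pdivlMr//.
set p := Num.sqrt a; set q := Num.sqrt b.
have p0 : 0 <= p by exact: sqrtr_ge0.
have q0 : 0 <= q by exact: sqrtr_ge0.
have -> : a = p ^+ 2 by rewrite sqr_sqrtr.
have -> : b = q ^+ 2 by rewrite sqr_sqrtr.
rewrite subr_sqr exprMn; apply: ler_wpM2l; first exact: sqr_ge0.
have : 0 <= p * q by exact: mulr_ge0.
rewrite sqrrD; lra.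
Qed.

(** * Information bound on the cube *)

Lemma card_cube (R : realType) (I : finType) (g : I -> bool -> R) :
  (forall i, g i true + g i false = 2) ->
  \sum_(z : {ffun I -> bool}) \prod_i g i (z i) = #|{ffun I -> bool}|%:R.
Proof.
move=> g2; rewrite -bigA_distr_bigA/= card_ffun card_bool natrX.
rewrite -prodr_const; apply: eq_bigr => i _.
by rewrite big_bool/= g2.
Qed.

Definition marginal (R : realType) (I : finType) (w : {ffun I -> bool} -> R)
    (i : I) (b : bool) : R :=
  \sum_(z : {ffun I -> bool} | z i == b) w z.

Lemma marginalD (R : realType) (I : finType) (w : {ffun I -> bool} -> R) (i : I) :
  marginal w i true + marginal w i false = \sum_z w z.
Proof.
rewrite /marginal [RHS](bigID (fun z : {ffun I -> bool} => z i == true))/=.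
by congr (_ + _); apply: eq_bigl => z; case: (z i).
Qed.

Lemma marginalB (R : realType) (I : finType) (w : {ffun I -> bool} -> R) (i : I) :
  marginal w i true - marginal w i false =
  \sum_(z : {ffun I -> bool}) w z * (if z i then 1 else -1).
Proof.
rewrite /marginal [RHS](bigID (fun z : {ffun I -> bool} => z i == true))/=.
rewrite -sumrN; congr (_ + _).
  by apply: eq_bigr => z /eqP ->; rewrite mulr1.
apply: eq_big => [z|z]; first by case: (z i).
by move/eqP=> ->; rewrite mulrN1.
Qed.

(* The test function [t_k z = \prod_i (1 + b_(k,i) chi_i z / 4)], where [b_(k,i)]
   is the bias of the [i]th bit under [w_k], has total mass [#|cube|]; the tangent
   inequality for [ln] at [2 ^ c] bounds the [w_k]-averages of [ln t_k]. *)
Lemma marginal_hellinger_le (R : realType) (I : finType) (T : Type) (r : seq T)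
    (w : T -> {ffun I -> bool} -> R) (c : nat) :
  (forall k z, 0 <= w k z <= 1) -> (forall z, \sum_(k <- r) w k z = 1) ->
  (size r <= 2 ^ c)%N ->
  \sum_(k <- r) \sum_i
    (Num.sqrt (marginal (w k) i true) - Num.sqrt (marginal (w k) i false)) ^+ 2
  <= 8 * #|{ffun I -> bool}|%:R * c%:R.
Proof.
move=> w01 w1 sr.
pose W : R := #|{ffun I -> bool}|%:R.
pose N k := \sum_z w k z.
pose b k i := (marginal (w k) i true - marginal (w k) i false) / N k.
pose u k i (e : bool) : R := b k i * (if e then 1 else -1) / 4.
pose t k (z : {ffun I -> bool}) := \prod_i (1 + u k i (z i)).
have m0 k i e : 0 <= marginal (w k) i e.
  by apply: sumr_ge0 => z _; case/andP: (w01 k z).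
have N0 k : 0 <= N k by apply: sumr_ge0 => z _; case/andP: (w01 k z).
have Nb k i : N k * b k i = marginal (w k) i true - marginal (w k) i false.
  have [Nk0|Nk0] := eqVneq (N k) 0; last by rewrite /b mulrC divfK.
  have := m0 k i true; have := m0 k i false.
  by have := marginalD (w k) i; rewrite -/(N k) Nk0 => ? ? ?; lra.
have b1 k i : -1 <= b k i <= 1.
  have [Nk0|Nk0] := eqVneq (N k) 0; first by rewrite /b Nk0 invr0 mulr0; lra.
  have Np : 0 < N k by rewrite lt_def Nk0 N0.
  have := m0 k i true; have := m0 k i false.
  have := marginalD (w k) i; rewrite -/(N k) /b => ? ? ?.
  by rewrite ler_pdivrMr// ler_pdivlMr//; apply/andP; split; lra.
(* The factor 1/4 in [u] is what brings it into the range of [ln_ge_quadratic]. *)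
have u1 k i e : - (1 / 4) <= u k i e.
  by have := b1 k i; rewrite /u; case: e => /andP[? ?]; lra.
have t0 k z : 0 < t k z /\ ln (t k z) = \sum_i ln (1 + u k i (z i)).
  by apply: ln_prod_pos => i; have := u1 k i (z i); lra.
have tW k : \sum_z t k z = W.
  by apply: (card_cube (g := fun i e => 1 + u k i e)) => i; rewrite /u; lra.
have K0 : 0 < 2 ^+ c :> R by exact: exprn_gt0.
(* For each [i] the linear term averages to [b ^+ 2 / 4] and the quadratic one costs
   [2 * (b / 4) ^+ 2 = b ^+ 2 / 8]. *)
have lower k : N k * (\sum_i b k i ^+ 2) / 8 <= \sum_z w k z * ln (t k z).
  have -> : N k * (\sum_i b k i ^+ 2) / 8 =
      \sum_z w k z * \sum_i (u k i (z i) - 2 * u k i (z i) ^+ 2).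
    under [RHS]eq_bigr do rewrite big_distrr/=.
    rewrite exchange_big/= big_distrr/= big_distrl/=; apply: eq_bigr => i _.
    have -> : N k * b k i ^+ 2 / 8 = (N k * b k i) * b k i / 4 - N k * b k i ^+ 2 / 8.
      by field.
    rewrite Nb marginalB /N !big_distrl/= -sumrB; apply: eq_bigr => z _.
    by rewrite /u; case: (z i); field.
  apply: ler_sum => z _; apply: ler_wpM2l; first by case/andP: (w01 k z).
  by rewrite (t0 k z).2; apply: ler_sum => i _; exact: ln_ge_quadratic.
(* Since [w k z <= 1], the tangent term [w k z * t k z / 2 ^+ c] is at most [t k z / 2 ^+ c]. These
   sum to at most [W], as there are at most [2 ^ c] indices, and the [- 1] of the tangent cancels
   them. *)
have upper : \sum_(k <- r) \sum_z w k z * ln (t k z) <= W * c%:R.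
  have lnK : ln (2 ^+ c : R) <= c%:R.
    rewrite lnXn// -[leLHS]mulr_natr ler_piMl//.
    by have := @le_ln1Dx R 1; lra.
  apply: (@le_trans _ _ (\sum_(k <- r) \sum_z (w k z * (ln (2 ^+ c) - 1) + t k z / 2 ^+ c))).
    apply: ler_sum => k _; apply: ler_sum => z _.
    case/andP: (w01 k z) => w0 wle.
    have [tp _] := t0 k z.
    apply: (@le_trans _ _ (w k z * (ln (2 ^+ c) + t k z / 2 ^+ c - 1))).
      by apply: ler_wpM2l => //; exact: ln_le_tangent.
    have : 0 <= (1 - w k z) * (t k z / 2 ^+ c).
      by apply: mulr_ge0; [lra|rewrite divr_ge0 ?ltW].
    lra.
  under eq_bigr do rewrite big_split/= -big_distrl/= -[X in _ + X]big_distrl/= tW.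
  rewrite big_split/= -big_distrl/= exchange_big/=.
  under eq_bigr do rewrite w1.
  rewrite sumr_const -/W big_const_seq count_predT iter_addr_0 -[_ *+ size r]mulr_natr.
  have : W / 2 ^+ c * (size r)%:R <= W.
    rewrite mulrAC ler_pdivrMr// ler_wpM2l ?ler0n//.
    by rewrite -natrX ler_nat.
  have : W * ln (2 ^+ c) <= W * c%:R by rewrite ler_wpM2l ?ler0n.
  rewrite -/W => ? ?; lra.
apply: (@le_trans _ _ (8 * \sum_(k <- r) \sum_z w k z * ln (t k z))); last first.
  by rewrite -mulrA ler_wpM2l.
rewrite big_distrr/=; apply: ler_sum => k _.
apply: le_trans (_ : N k * (\sum_i b k i ^+ 2) <= _); last by have := lower k; lra.
rewrite big_distrr/=; apply: ler_sum => i _.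
by rewrite /b /N -(marginalD (w k) i); exact: sqr_sqrtB_le.
Qed.

(** * Splitting a random input between the players *)

Definition mask (I : finType) (d z : {ffun I -> bool}) : {ffun I -> bool} :=
  [ffun i => d i && z i].

Definition ccompl (I : finType) (d : {ffun I -> bool}) : {ffun I -> bool} :=
  [ffun i => ~~ d i].

Definition upd (I : finType) (z : {ffun I -> bool}) (i : I) (b : bool) :
    {ffun I -> bool} :=
  [ffun j => if j == i then b else z j].

Lemma upd_mask_upd (I : finType) (d z : {ffun I -> bool}) (i : I) (a b : bool) :
  upd (mask d (upd z i b)) i a = upd (mask d z) i a.
Proof. by apply/ffunP => j; rewrite !ffunE; case: eqP. Qed.

Lemma upd_mask_updl (I : finType) (d z : {ffun I -> bool}) (i : I) (a b : bool) :
  upd (mask (upd d i b) z) i a = upd (mask d z) i a.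
Proof. by apply/ffunP => j; rewrite !ffunE; case: eqP. Qed.

Lemma upd_mask_ccompl_upd (I : finType) (d z : {ffun I -> bool}) (i : I) (a b : bool) :
  upd (mask (ccompl (upd d i b)) z) i a = upd (mask (ccompl d) z) i a.
Proof. by apply/ffunP => j; rewrite !ffunE; case: eqP. Qed.

Lemma upd_mask_id (I : finType) (d z : {ffun I -> bool}) (i : I) :
  upd (mask d z) i (d i && z i) = mask d z.
Proof. by apply/ffunP => j; rewrite !ffunE; case: eqP => [->|]. Qed.

Lemma marginal_half (R : realType) (I : finType) (F : {ffun I -> bool} -> R)
    (i : I) (a : bool) :
  (forall z b, F (upd z i b) = F z) -> marginal F i a = (\sum_z F z) / 2.
Proof.
move=> Fi; rewrite -(marginalD F i).
suff E : marginal F i true = marginal F i false.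
  by case: a; rewrite E; field.
rewrite /marginal.
have updK : involutive (fun z : {ffun I -> bool} => upd z i (~~ z i)).
  move=> z; apply/ffunP => j; rewrite !ffunE eqxx.
  by case: eqP => // ->; rewrite negbK.
rewrite (reindex_inj (inv_inj updK)); apply: eq_big => [z|z _].
  by rewrite !ffunE eqxx; case: (z i).
exact: Fi.
Qed.

(** The two masks read disjoint coordinates of [z], so they are independent for uniform [z].
    Swapping the coordinates outside [d] between two copies of [z] makes both factors depend on the
    first copy alone. *)
Lemma mask_independent (R : realType) (I : finType) (d : {ffun I -> bool})
    (f g : {ffun I -> bool} -> R) :
  #|{ffun I -> bool}|%:R * \sum_z f (mask d z) * g (mask (ccompl d) z) =
  (\sum_z f (mask d z)) * (\sum_z g (mask (ccompl d) z)).
Proof.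
pose mix (z z' : {ffun I -> bool}) : {ffun I -> bool} :=
  [ffun j => if d j then z j else z' j].
have mixK : involutive
    (fun p : {ffun I -> bool} * {ffun I -> bool} => (mix p.1 p.2, mix p.2 p.1)).
  by move=> [z z'] /=; congr (_, _); apply/ffunP => j; rewrite !ffunE; case: (d j).
rewrite [RHS]big_distrlr/= pair_big/= (reindex_inj (inv_inj mixK))/=.
rewrite -(pair_big predT predT (fun z z' : {ffun I -> bool} =>
  f (mask d (mix z z')) * g (mask (ccompl d) (mix z' z))))/=.
rewrite big_distrr/=; apply: eq_bigr => z _.
rewrite (_ : _ * _ = \sum_(z' : {ffun I -> bool})
  f (mask d z) * g (mask (ccompl d) z)); last first.
  by rewrite sumr_const mulr_natl.
by apply: eq_bigr => z' _; congr (f _ * g _); apply/ffunP => j;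
  rewrite !ffunE; case: (d j).
Qed.

(** * Cut and paste on rectangles *)

Lemma sqr_sqrtB_half (R : rcfType) (a b : R) : 0 <= a -> 0 <= b ->
  (Num.sqrt (a / 2) - Num.sqrt (b / 2)) ^+ 2 =
  (Num.sqrt a - Num.sqrt b) ^+ 2 / 2.
Proof.
by move=> a0 b0; rewrite !sqrtrM// -mulrBl exprMn sqr_sqrtr// invr_ge0.
Qed.

(** By [a * e = c * d], the bracket after 6 is [(a - e) ^+ 2 - (c - d) ^+ 2], while the term with 12
    is [6 * (c - d) ^+ 2 + 6 * (c + d - 2 * e) ^+ 2]; together they are at least [6 * (a - e) ^+ 2].
    Then [(a - e) * (a + e) <= 6 * (a - e) ^+ 2 + (a + e) ^+ 2 / 24] by AM-GM. *)
Lemma cut_and_paste_sqr (R : realFieldType) (a c d e : R) :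
  a * e = c * d ->
  a ^+ 2 - e ^+ 2 <= 12 * ((c - e) ^+ 2 + (d - e) ^+ 2)
    + 6 * (a ^+ 2 + e ^+ 2 - c ^+ 2 - d ^+ 2) + (a ^+ 2 + e ^+ 2) / 12
  /\
  0 <= 12 * ((c - e) ^+ 2 + (d - e) ^+ 2)
    + 6 * (a ^+ 2 + e ^+ 2 - c ^+ 2 - d ^+ 2) + (a ^+ 2 + e ^+ 2) / 12.
Proof.
move=> ae.
have h1 : 0 <= (c + d - 2 * e) ^+ 2 by exact: sqr_ge0.
have h2 : 0 <= (a - e) ^+ 2 by exact: sqr_ge0.
have h3 : 0 <= ((a - e) - (a + e) / 12) ^+ 2 by exact: sqr_ge0.
have h4 : 0 <= a ^+ 2 by exact: sqr_ge0.
have h5 : 0 <= e ^+ 2 by exact: sqr_ge0.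
by split; lra.
Qed.

(* The cut-and-paste identity [p11 p00 = p10 p01] makes the Hellinger distances
   between [p11] and [p00] and between [p10] and [p01] agree up to the linear
   term, which vanishes once summed over the rectangles of a partition. *)
Lemma cut_and_paste_le (R : rcfType) (p00 p01 p10 p11 : R) :
  0 <= p00 -> 0 <= p01 -> 0 <= p10 -> 0 <= p11 -> p11 * p00 = p10 * p01 ->
  p11 - p00 <=
    12 * ((Num.sqrt p10 - Num.sqrt p00) ^+ 2 + (Num.sqrt p01 - Num.sqrt p00) ^+ 2)
    + 6 * (p11 + p00 - p10 - p01) + (p11 + p00) / 12
  /\
  0 <=
    12 * ((Num.sqrt p10 - Num.sqrt p00) ^+ 2 + (Num.sqrt p01 - Num.sqrt p00) ^+ 2)
    + 6 * (p11 + p00 - p10 - p01) + (p11 + p00) / 12.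
Proof.
move=> h00 h01 h10 h11 pE.
have := @cut_and_paste_sqr R (Num.sqrt p11) (Num.sqrt p10) (Num.sqrt p01) (Num.sqrt p00).
by rewrite !sqr_sqrtr// -!sqrtrM ?pE//; apply.
Qed.

(** Up to the factor [#|{ffun I -> bool}|], the probability over [z] that the players reach the
    rectangle [A], [B] when their bits in coordinate [i] are forced to [a] and [b]. *)
Definition rect_count (R : realType) (I : finType) (A B : {ffun I -> bool} -> bool)
    (i : I) (a b : bool) (d : {ffun I -> bool}) : R :=
  \sum_z (A (upd (mask d z) i a) && B (upd (mask (ccompl d) z) i b))%:R.

Lemma rect_count_ge0 (R : realType) (I : finType) (A B : {ffun I -> bool} -> bool)
    (i : I) (a b : bool) (d : {ffun I -> bool}) : 0 <= rect_count R A B i a b d.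
Proof. by apply: sumr_ge0. Qed.

Lemma rect_count_upd (R : realType) (I : finType) (A B : {ffun I -> bool} -> bool)
    (i : I) (a b : bool) (d : {ffun I -> bool}) (e : bool) :
  rect_count R A B i a b (upd d i e) = rect_count R A B i a b d.
Proof.
by apply: eq_bigr => z _; rewrite upd_mask_updl upd_mask_ccompl_upd.
Qed.

(** For fixed [d] the players' inputs are independent, so the count splits into a factor depending
    on [a] and one depending on [b]. *)
Lemma rect_count_cut (R : realType) (I : finType) (A B : {ffun I -> bool} -> bool)
    (i : I) (d : {ffun I -> bool}) :
  rect_count R A B i true true d * rect_count R A B i false false d =
  rect_count R A B i true false d * rect_count R A B i false true d.
Proof.
have factor a b : #|{ffun I -> bool}|%:R * rect_count R A B i a b d =
    (\sum_z (A (upd (mask d z) i a))%:R) *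
    (\sum_z (B (upd (mask (ccompl d) z) i b))%:R).
  rewrite -(mask_independent d (fun x => (A (upd x i a))%:R)
    (fun y => (B (upd y i b))%:R)).
  by congr (_ * _); apply: eq_bigr => z _; rewrite -natrM mulnb.
have W0 : #|{ffun I -> bool}|%:R != 0 :> R.
  by rewrite pnatr_eq0 card_ffun card_bool expn_eq0.
apply: (mulfI (mulf_neq0 W0 W0)).
by rewrite [LHS]mulrACA [RHS]mulrACA !factor mulrACA [RHS]mulrACA
  [in RHS](mulrC (\sum_z (B _)%:R)).
Qed.

(** The bit [z i] goes to Alice if [d i] and to Bob otherwise, the other player seeing 0 there. The
    half appears because [rect_count] lets [z i] range over both values. *)
Lemma marginal_rect (R : realType) (I : finType) (A B : {ffun I -> bool} -> bool)
    (i : I) (a : bool) (d : {ffun I -> bool}) :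
  marginal (fun z => (A (mask d z) && B (mask (ccompl d) z))%:R : R) i a =
  (if d i then rect_count R A B i a false d else rect_count R A B i false a d) / 2.
Proof.
rewrite /rect_count; case di : (d i).
  rewrite -(marginal_half (i := i) a); last by move=> z b; rewrite !upd_mask_upd.
  apply: eq_bigr => z /eqP zi.
  by rewrite -{1}(upd_mask_id d z i) -{1}(upd_mask_id (ccompl d) z i) ffunE di zi.
rewrite -(marginal_half (i := i) a); last by move=> z b; rewrite !upd_mask_upd.
apply: eq_bigr => z /eqP zi.
by rewrite -{1}(upd_mask_id d z i) -{1}(upd_mask_id (ccompl d) z i) ffunE di zi.
Qed.

(** One factor 2 comes from the half in [marginal_rect]. The other arises because each of the two
    distances ignores [d i], yet only the [d] with one value of [d i] display it as a marginal. *)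
Lemma sum_marginal_hellinger (R : realType) (I : finType)
    (A B : {ffun I -> bool} -> bool) (i : I) :
  let p := rect_count R A B i in
  let w d z := (A (mask d z) && B (mask (ccompl d) z))%:R : R in
  \sum_d ((Num.sqrt (p true false d) - Num.sqrt (p false false d)) ^+ 2
        + (Num.sqrt (p false true d) - Num.sqrt (p false false d)) ^+ 2) =
  4 * \sum_d (Num.sqrt (marginal (w d) i true)
            - Num.sqrt (marginal (w d) i false)) ^+ 2.
Proof.
move=> p w.
rewrite big_split/=.
pose F1 d := (Num.sqrt (p true false d) - Num.sqrt (p false false d)) ^+ 2.
pose F0 d := (Num.sqrt (p false true d) - Num.sqrt (p false false d)) ^+ 2.
have E1 : marginal F1 i true = (\sum_d F1 d) / 2.
  by apply: marginal_half => d e; rewrite /F1 /p !rect_count_upd.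
have E0 : marginal F0 i false = (\sum_d F0 d) / 2.
  by apply: marginal_half => d e; rewrite /F0 /p !rect_count_upd.
pose G d := (Num.sqrt (marginal (w d) i true) - Num.sqrt (marginal (w d) i false)) ^+ 2.
rewrite -(marginalD G i).
have -> : marginal G i true = marginal F1 i true / 2.
  rewrite /marginal big_distrl/=; apply: eq_bigr => d /eqP di.
  by rewrite /G /w !marginal_rect di sqr_sqrtB_half ?rect_count_ge0.
have -> : marginal G i false = marginal F0 i false / 2.
  rewrite /marginal big_distrl/=; apply: eq_bigr => d /eqP di.
  by rewrite /G /w !marginal_rect di sqr_sqrtB_half ?rect_count_ge0.
by rewrite E1 E0 /F1 /F0; field.
Qed.

(** * Advantage of rectangle partitions and deterministic protocols *)

Lemma sum_rect_count (R : realType) (I : finType) (T : Type) (r : seq T)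
    (A B : T -> {ffun I -> bool} -> bool) (i : I) (a b : bool) (d : {ffun I -> bool}) :
  (forall x y, \sum_(k <- r) (A k x && B k y)%:R = 1 :> R) ->
  \sum_(k <- r) rect_count R (A k) (B k) i a b d = #|{ffun I -> bool}|%:R.
Proof.
by move=> r1; rewrite exchange_big/=; under eq_bigr do rewrite r1; rewrite sumr_const.
Qed.

Lemma rect_partition_advantage_le (R : realType) (I : finType) (T : Type)
    (r : seq T) (A B : T -> {ffun I -> bool} -> bool) (ans : T -> bool) (c : nat) :
  (forall x y, \sum_(k <- r) (A k x && B k y)%:R = 1 :> R) ->
  (size r <= 2 ^ c)%N ->
  \sum_i \sum_d \sum_(k <- r) (ans k)%:R *
    (rect_count R (A k) (B k) i true true d - rect_count R (A k) (B k) i false false d)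
  <= #|{ffun I -> bool}|%:R ^+ 2 * (384 * c%:R + #|I|%:R / 6).
Proof.
move=> r1 sr; set W : R := #|{ffun I -> bool}|%:R.
pose p i k a b d := rect_count R (A k) (B k) i a b d.
pose h i k d := (Num.sqrt (p i k true false d) - Num.sqrt (p i k false false d)) ^+ 2
  + (Num.sqrt (p i k false true d) - Num.sqrt (p i k false false d)) ^+ 2.
have H : \sum_i \sum_d \sum_(k <- r) h i k d <= 32 * W ^+ 2 * c%:R.
  have -> : \sum_i \sum_d \sum_(k <- r) h i k d = 4 * \sum_d \sum_(k <- r) \sum_i
      (Num.sqrt (marginal (fun z => (A k (mask d z) && B k (mask (ccompl d) z))%:R) i true)
     - Num.sqrt (marginal (fun z => (A k (mask d z) && B k (mask (ccompl d) z))%:R) i false)) ^+ 2.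
    under [X in 4 * X]eq_bigr do rewrite exchange_big/=.
    rewrite [X in 4 * X]exchange_big/= big_distrr/=; apply: eq_bigr => i _.
    rewrite exchange_big/= [X in 4 * X]exchange_big/= big_distrr/=.
    by apply: eq_bigr => k _; exact: sum_marginal_hellinger.
  apply: (@le_trans _ _ (4 * \sum_(d : {ffun I -> bool}) 8 * W * c%:R)).
    rewrite ler_wpM2l//; apply: ler_sum => d _.
    apply: (marginal_hellinger_le (w := fun k z =>
      (A k (mask d z) && B k (mask (ccompl d) z))%:R)) => //.
    by move=> k z; rewrite ler0n lern1 leq_b1.
  by rewrite sumr_const -[_ *+ _]mulr_natr -/W; lra.
apply: (@le_trans _ _ (\sum_i \sum_d \sum_(k <- r) (12 * h i k d
   + 6 * (p i k true true d + p i k false false d - p i k true false d - p i k false true d)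
   + (p i k true true d + p i k false false d) / 12))).
  apply: ler_sum => i _; apply: ler_sum => d _; apply: ler_sum => k _.
  have [] := @cut_and_paste_le R (p i k false false d) (p i k false true d)
    (p i k true false d) (p i k true true d); rewrite ?rect_count_ge0//.
    exact: rect_count_cut.
  (* Leaves answering [false] contribute 0, which is why nonnegativity of the bound is also
     needed. *)
  by case: (ans k); rewrite ?mul1r ?mul0r.
(* Each of the four counts sums to [W] over the partition, so the term with 6 cancels and the last
   one gives [2 * W / 12]. *)
have S i d : \sum_(k <- r) (12 * h i k d
   + 6 * (p i k true true d + p i k false false d - p i k true false d - p i k false true d)
   + (p i k true true d + p i k false false d) / 12)
   = 12 * (\sum_(k <- r) h i k d) + W / 6.
  rewrite !big_split/= -!big_distrr/= -big_distrl/= !big_split/= !sumrN.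
  by rewrite /p !sum_rect_count// -/W; field.
under eq_bigr do under eq_bigr do rewrite S.
under eq_bigr do rewrite big_split/= -big_distrr/= sumr_const -[_ *+ _]mulr_natr -/W.
rewrite big_split/= -big_distrr/= sumr_const -[X in _ + X]mulr_natr.
by rewrite expr2 in H *; lra.
Qed.

(* The leaves of the protocol tree cut at depth [c], as combinatorial rectangles
   with their answers. The cut matters: [cost] only bounds the branches that some
   input reaches. *)
Fixpoint leaves (X Y : Type) (c : nat) (p : protocol X Y) :
    seq ((X -> bool) * (Y -> bool) * bool) :=
  match c, p with
  | _, Answer b => [:: (xpredT, xpredT, b)]
  | 0, _ => [:: (xpredT, xpredT, false)]
  | c'.+1, AliceSends a p1 p0 =>
      [seq (fun x => a x && k.1.1 x, k.1.2, k.2) | k <- leaves c' p1] ++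
      [seq (fun x => ~~ a x && k.1.1 x, k.1.2, k.2) | k <- leaves c' p0]
  | c'.+1, BobSends b p1 p0 =>
      [seq (k.1.1, fun y => b y && k.1.2 y, k.2) | k <- leaves c' p1] ++
      [seq (k.1.1, fun y => ~~ b y && k.1.2 y, k.2) | k <- leaves c' p0]
  end.

Lemma size_leaves (X Y : Type) (c : nat) (p : protocol X Y) :
  (size (leaves c p) <= 2 ^ c)%N.
Proof.
elim: c p => [|c IH] [b|a p1 p0|a p1 p0] //=; first by rewrite expn_gt0.
  by rewrite size_cat !size_map expnS mul2n -addnn leq_add.
by rewrite size_cat !size_map expnS mul2n -addnn leq_add.
Qed.

Lemma leaves_partition (R : realType) (X Y : Type) (c : nat) (p : protocol X Y)
    (x : X) (y : Y) :
  \sum_(k <- leaves c p) (k.1.1 x && k.1.2 y)%:R = 1 :> R.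
Proof.
elim: c p => [|c IH] [b|a p1 p0|a p1 p0] /=; rewrite ?big_seq1//.
  rewrite big_cat !big_map/=; case: (a x) => /=.
    by rewrite IH big1 ?addr0.
  by rewrite IH big1 ?add0r.
rewrite big_cat !big_map/=; case: (a y) => /=.
  by rewrite IH [X in _ + X]big1 ?addr0// => k _; rewrite andbF.
by rewrite IH big1 ?add0r// => k _; rewrite andbF.
Qed.

Lemma leaves_run (R : realType) (X Y : Type) (c : nat) (p : protocol X Y)
    (x : X) (y : Y) : (bits_sent p x y <= c)%N ->
  \sum_(k <- leaves c p) k.2%:R * (k.1.1 x && k.1.2 y)%:R = (run p x y)%:R :> R.
Proof.
elim: c p => [|c IH] [b|a p1 p0|a p1 p0] //=;
  rewrite ?big_seq1/= ?mulr1// big_cat !big_map/=.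
  case: (a x) => /= hc; rewrite IH//.
    by rewrite big1 ?addr0// => k _; rewrite mulr0.
  by rewrite big1 ?add0r// => k _; rewrite mulr0.
case: (a y) => /= hc; rewrite IH//.
  by rewrite [X in _ + X]big1 ?addr0// => k _; rewrite andbF mulr0.
by rewrite big1 ?add0r// => k _; rewrite andbF mulr0.
Qed.

Lemma run_advantage_le (R : realType) (I X Y : finType) (p : protocol X Y) (c : nat)
    (f : {ffun I -> bool} -> X) (g : {ffun I -> bool} -> Y) :
  (cost p <= c)%N ->
  \sum_i \sum_d \sum_z
    ((run p (f (upd (mask d z) i true)) (g (upd (mask (ccompl d) z) i true)))%:R -
     (run p (f (upd (mask d z) i false)) (g (upd (mask (ccompl d) z) i false)))%:R)
  <= #|{ffun I -> bool}|%:R ^+ 2 * (384 * c%:R + #|I|%:R / 6) :> R.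
Proof.
move=> pc.
have bits x y : (bits_sent p x y <= c)%N.
  by apply: leq_trans pc; exact: (leq_bigmax (x, y)).
apply: le_trans (@rect_partition_advantage_le R I _ (leaves c p)
  (fun k => k.1.1 \o f) (fun k => k.1.2 \o g) (fun k => k.2) c _ (size_leaves c p));
  last by move=> x y; exact: leaves_partition.
rewrite le_eqVlt; apply/orP; left; apply/eqP.
apply: eq_bigr => i _; apply: eq_bigr => d _.
rewrite /rect_count; under [RHS]eq_bigr do rewrite -sumrB big_distrr/=.
rewrite exchange_big/=; apply: eq_bigr => z _.
by rewrite -2!(leaves_run R (bits _ _)) -sumrB; apply: eq_bigr => k _; rewrite mulrBr.
Qed.

(** * Averaging over the coins *)

Lemma card_expectation_le (R : realType) (dp : measure_display)
    (Omega : measurableType dp) (P : probability Omega R) (J : finType)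
    (E : J -> set Omega) (q B : R) :
  (forall j, measurable (E j) /\ (q%:E <= P (E j))%E) ->
  (forall w, \sum_j \1_(E j) w <= B) -> q * #|J|%:R <= B.
Proof.
move=> hE hB.
have mE j : measurable (E j) := (hE j).1.
have m1 j : measurable_fun setT (EFin \o (\1_(E j) : Omega -> R)).
  by apply/measurable_EFinP; exact: measurable_indic.
have p1 j w : (0 <= (\1_(E j) w : R)%:E)%E by rewrite lee_fin.
rewrite -lee_fin.
apply: (@le_trans _ _ (\sum_j P (E j))%E).
  have -> : (q * #|J|%:R)%:E = (\sum_(j : J) q%:E)%E.
    by rewrite sumEFin sumr_const mulr_natr.
  by apply: lee_sum => j _; exact: (hE j).2.
(* Linearity of expectation: the left side is the expected number of events that occur. *)
have -> : (\sum_j P (E j) = \int[P]_w (\sum_j \1_(E j) w)%:E)%E.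
  under [RHS]eq_integral do rewrite -sumEFin.
  rewrite ge0_integral_sum//.
  by apply: eq_bigr => j _; rewrite integral_indic// setIT.
have -> : B%:E = (\int[P]_w (cst B%:E) w)%E.
  by rewrite integral_cst// -[RHS]/(B%:E * P setT)%E probability_setT mule1.
apply: ge0_le_integral => //.
- by move=> w _; rewrite -sumEFin; apply: sume_ge0.
- by under eq_fun do rewrite -sumEFin; apply: emeasurable_sum.
- by move=> w _; rewrite lee_fin.
Qed.

(* Both inputs of a pair below are intersecting for [b = true] and disjoint for
   [b = false], and they differ only in the coordinate [i]. *)
Lemma rand_disjointness_bound (R : realType) (dp : measure_display)
    (Omega : measurableType dp) (P : probability Omega R) (I X Y : finType)
    (prot : Omega -> protocol X Y) (F : X -> Y -> bool) (c : nat)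
    (f : {ffun I -> bool} -> X) (g : {ffun I -> bool} -> Y) :
  (forall x y, F (f x) (g y) = [exists i, x i && y i]) ->
  rand_solves P prot F -> rand_cost_le prot c ->
  #|I|%:R <= 2304 * c%:R :> R.
Proof.
move=> fgF sol pc.
pose x (i : I) (d z : {ffun I -> bool}) b := f (upd (mask d z) i b).
pose y (i : I) (d z : {ffun I -> bool}) b := g (upd (mask (ccompl d) z) i b).
(* Outside [i] the two masks have disjoint supports, so the inputs can only meet at [i]. *)
have Fxy i d z b : F (x i d z b) (y i d z b) = b.
  rewrite fgF; apply/existsP; case: b => [|[j]]; first by exists i; rewrite !ffunE eqxx.
  by rewrite !ffunE; case: eqP => //= _; case: (d j) => //=; rewrite andbF.
set W : R := #|{ffun I -> bool}|%:R.
have W0 : 0 < W by rewrite ltr0n card_ffun card_bool expn_gt0.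
pose cube := {ffun I -> bool}.
pose E i d z b : set Omega :=
  [set w | run (prot w) (x i d z b) (y i d z b) = F (x i d z b) (y i d z b)]%classic.
pose Ej (j : I * (cube * (cube * bool))) := E j.1 j.2.1 j.2.2.1 j.2.2.2.
have indicE_E i d z b w :
    \1_(E i d z b) w = (run (prot w) (x i d z b) (y i d z b) == b)%:R :> R.
  by rewrite indicE; congr ((nat_of_bool _)%:R); apply/idP/eqP; rewrite in_setE /E /= Fxy.
(* Correctness is the answer itself on the intersecting pair and its complement to 1 on the disjoint
   pair. *)
have sumE w : \sum_j \1_(Ej j) w = \sum_i \sum_d \sum_z
    (1 + ((run (prot w) (x i d z true) (y i d z true))%:R
        - (run (prot w) (x i d z false) (y i d z false))%:R)) :> R.
  rewrite -(pair_bigA _ (fun i j => \1_(E i j.1 j.2.1 j.2.2) w))/=; apply: eq_bigr => i _.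
  rewrite -(pair_bigA _ (fun d j => \1_(E i d j.1 j.2) w))/=; apply: eq_bigr => d _.
  rewrite -(pair_bigA _ (fun z b => \1_(E i d z b) w))/=; apply: eq_bigr => z _.
  rewrite big_bool/= !indicE_E.
  by case: (run _ _ _); case: (run _ _ _) => /=; lra.
have := @card_expectation_le R dp Omega P _ Ej (2 / 3)
  (#|I|%:R * W ^+ 2 + W ^+ 2 * (384 * c%:R + #|I|%:R / 6)).
rewrite !card_prod card_bool !natrM -/W => h.
(* Divided by [W ^+ 2], this reads [4/3 |I| <= |I| + 384 c + |I| / 6], so [|I| / 6 <= 384 c], and
   [2304 = 6 * 384]. *)
suff : 2 / 3 * (#|I|%:R * (W * (W * 2))) <=
    #|I|%:R * W ^+ 2 + W ^+ 2 * (384 * c%:R + #|I|%:R / 6).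
  move=> {}h.
  have : W ^+ 2 * #|I|%:R <= W ^+ 2 * (2304 * c%:R) by rewrite expr2 in h *; lra.
  by rewrite ler_pM2l// exprn_gt0.
apply: h => [j|w]; first exact: sol.
rewrite sumE.
under eq_bigr do under eq_bigr do rewrite big_split/= sumr_const.
under eq_bigr do rewrite big_split/= sumr_const -mulr_natl -/W.
rewrite big_split/= sumr_const.
apply: lerD; first by rewrite -[leLHS]mulr_natl expr2.
exact: run_advantage_le.
Qed.

(** * Encoding disjointness into orthogonal vectors *)

Definition bit (i k : nat) : bool := odd (i %/ 2 ^ k).

Lemma bit_inj (e i j : nat) : (i < 2 ^ e)%N -> (j < 2 ^ e)%N ->
  (forall k, (k < e)%N -> bit i k = bit j k) -> i = j.
Proof.
elim: e i j => [|e IH] i j; first by rewrite expn0 !ltnS !leqn0 => /eqP-> /eqP->.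
move=> hi hj h; rewrite -(odd_double_half i) -(odd_double_half j).
have := h 0 (ltn0Sn e); rewrite /bit expn0 !divn1 => ->; congr (_ + _.*2)%N.
apply: IH => [||k hk].
- by rewrite -divn2 ltn_divLR// -expnSr.
- by rewrite -divn2 ltn_divLR// -expnSr.
by have := h k.+1 hk; rewrite /bit expnS !divnMA !divn2.
Qed.

(* With opposite signs [s], the first [2 * e] coordinates of two such vectors are
   orthogonal iff the indices agree; the last coordinate is padding. *)
Definition index_vec (e : nat) (s : bool) (i : nat) (u v : bool) :
    bitvec (2 * e + 3) :=
  [ffun k : 'I__ =>
     if (k < e)%N then s (+) bit i k
     else if (k < 2 * e)%N then ~~ (s (+) bit i (k - e))
     else if k == 2 * e :> nat then u
     else if k == (2 * e).+1 :> nat then v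
     else false].

Lemma index_vec_inj (e : nat) (s : bool) (i j : nat) (u v u' v' : bool) :
  (i < 2 ^ e)%N -> (j < 2 ^ e)%N ->
  index_vec e s i u v = index_vec e s j u' v' -> i = j.
Proof.
move=> hi hj /ffunP h; apply: (bit_inj hi hj) => k hk.
have hk' : (k < 2 * e + 3)%N by rewrite mul2n -addnn -addnA ltn_addr.
by have := h (Ordinal hk'); rewrite !ffunE/= hk; apply: addbI.
Qed.

(** Coordinate [k] excludes bit 1 in [i] against 0 in [j], and coordinate [k + e] excludes the
    converse. The constant [true] facing each negated input bit then forces [a] and [b]. *)
Lemma orthogonal_index_vec (e i j : nat) (a b : bool) :
  (i < 2 ^ e)%N -> (j < 2 ^ e)%N ->
  orthogonal_bits (index_vec e false i (~~ a) true) (index_vec e true j true (~~ b))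
  = [&& i == j, a & b].
Proof.
move=> hi hj; rewrite /orthogonal_bits; apply/forallP/and3P => [h|[/eqP<- -> ->] k]; last first.
  rewrite !ffunE; case: ifP => _; first by case: (bit i k).
  case: ifP => _; first by case: (bit i _).
  by case: ifP => // _; case: ifP.
have hc k (hk : (k < 2 * e + 3)%N) := h (Ordinal hk).
have h0 : (2 * e < 2 * e + 3)%N by rewrite -[ltnLHS]addn0 ltn_add2l.
have h1 : ((2 * e).+1 < 2 * e + 3)%N by rewrite -addn1 ltn_add2l.
have e2 : (2 * e < e)%N = false by rewrite ltnNge mul2n -addnn leq_addr.
have e3 : ((2 * e).+1 < e)%N = false.
  by rewrite ltnNge ltnW// ltnS mul2n -addnn leq_addr.
split.
- apply/eqP; apply: (bit_inj hi hj) => k hk.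
  have k1 : (k < 2 * e + 3)%N by rewrite mul2n -addnn -addnA ltn_addr.
  have k2 : (k + e < 2 * e + 3)%N.
    by rewrite mul2n -addnn ltn_addr// ltn_add2r.
  have := hc _ k1; rewrite !ffunE/= hk.
  have := hc _ k2; rewrite !ffunE/= ltnNge leq_addl/= mul2n -addnn ltn_add2r hk addnK.
  by case: (bit i k); case: (bit j k).
- by have := hc _ h0; rewrite !ffunE/= e2 ltnn eqxx orbF; case: (a).
- by have := hc _ h1; rewrite !ffunE/= e3 ltnNge leqnSn/= gtn_eqF// eqxx; case: (b).
Qed.

(** The index prefix keeps the vectors distinct whatever the input bits, so they form a set of
    exactly [n] elements. *)
Lemma card_index_vecs (n : nat) (s : bool) (u v : 'I_n -> bool) :
  #|[set index_vec (up_log 2 n) s i (u i) (v i) | i : 'I_n]| == n.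
Proof.
have lt i : (val (i : 'I_n) < 2 ^ up_log 2 n)%N.
  by apply: leq_trans (ltn_ord i) _; exact: up_logP.
rewrite card_imset; first by rewrite card_ord.
by move=> i j /(index_vec_inj (lt i) (lt j))/val_inj.
Qed.

Definition index_vec_set (n : nat) (s : bool) (u v : 'I_n -> bool) :
    vec_set n (ov_dim n) :=
  exist (fun L : {set bitvec (ov_dim n)} => #|L| == n) _ (card_index_vecs s u v).

Lemma orthogonal_vectors_disjointness (n : nat) (x y : {ffun 'I_n -> bool}) :
  orthogonal_vectors (index_vec_set false (fun i => ~~ x i) xpredT)
                     (index_vec_set true xpredT (fun i => ~~ y i))
  = [exists i, x i && y i].
Proof.
have lt i : (val (i : 'I_n) < 2 ^ up_log 2 n)%N.
  by apply: leq_trans (ltn_ord i) _; exact: up_logP.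
apply/exists_inP/existsP => [[l /imsetP[i _ ->] /exists_inP[r /imsetP[j _ ->]]]|[i xy]].
  by rewrite (orthogonal_index_vec _ _ (lt i) (lt j)) => /and3P[/eqP/val_inj<- xi yi]; exists i; rewrite xi yi.
exists (index_vec (up_log 2 n) false i (~~ x i) true); first by apply/imsetP; exists i.
apply/exists_inP; exists (index_vec (up_log 2 n) true i true (~~ y i)).
  by apply/imsetP; exists i.
by rewrite (orthogonal_index_vec _ _ (lt i) (lt i)) eqxx.
Qed.

Theorem corollary2p2 (R : realType) :
  exists (eps : R) (n0 : nat), 0 < eps /\
    forall n : nat, (n0 <= n)%N ->
      (forall p : protocol (vec_set n (ov_dim n)) (vec_set n (ov_dim n)),
          solves p (@orthogonal_vectors n (ov_dim n)) ->
          eps * n%:R <= (cost p)%:R)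
      /\
      (forall (d : measure_display) (Omega : measurableType d)
              (P : probability Omega R)
              (prot : Omega -> protocol (vec_set n (ov_dim n))
                                        (vec_set n (ov_dim n)))
              (c : nat),
          rand_solves P prot (@orthogonal_vectors n (ov_dim n)) ->
          rand_cost_le prot c ->
          eps * n%:R <= c%:R).
Proof.
have lower n (dp : measure_display) (Omega : measurableType dp) (P : probability Omega R)
    (prot : Omega -> protocol (vec_set n (ov_dim n)) (vec_set n (ov_dim n))) c :
    rand_solves P prot (@orthogonal_vectors n (ov_dim n)) ->
    rand_cost_le prot c -> 2304^-1 * n%:R <= c%:R :> R.
  move=> sol pc.
  have := rand_disjointness_bound (@orthogonal_vectors_disjointness n) sol pc.
  by rewrite card_ord; lra.
exists 2304^-1, 0%N; split; first by lra.
move=> n _; split=> [p sol|]; last exact: lower.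
(* A deterministic protocol is a randomized one over a one-point space, correct with probability
   1. *)
apply: (lower n _ unit (dirac tt) (fun=> p)) => // x y.
have -> : [set w : unit | run p x y = orthogonal_vectors x y]%classic = setT.
  by apply/seteqP; split => // w _; exact: sol.
by split=> //; rewrite probability_setT lee_fin; lra.
Qed.
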